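(* Let $\beta>0$, let $k_n\ge 0$ satisfy $k_n=o(n^{\beta})$ as $n\to\infty$, and let $L_n(\boldsymbol{D})$ be the optimal value of the dual linear program with supplies $s_n(t_i)=n^{\beta}\gamma(t_i)$ and demand vector $\boldsymbol{D}=\boldsymbol{\mu}+RW\boldsymbol{\Psi}$ written in polar form. Let $T_n(\boldsymbol{\Psi})=P\{L_n(\boldsymbol{D})>k_n\mid\boldsymbol{\Psi}\}$. Then there exist constants $n_0>0$, $c_3>0$, $s^*>0$ and a quantity $\eta_1=\eta_1(n)=O(n^{\beta})$ such that when $n>n_0$, $$T_n(\boldsymbol{\Psi})\le P\{R>n^{\beta}s^*+\eta_1\}\qquad\text{for all }\|\boldsymbol{\Psi}\|=1,$$ and $$P\{L_n(\boldsymbol{D})>k_n\}\ge c_3\,P\{R>n^{\beta}s^*+O(1)\}\,n^{-(d-1)\beta},$$ where $O(1)$ stands for some deterministic function of $n$ that is bounded as $n\to\infty$. Also, the conditional Monte Carlo estimator $T_n(\boldsymbol{\Psi})$ is asymptotically optimal as an estimator for $\alpha_n(k_n)=P\{L_n(\boldsymbol{D})>k_n\}$.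
   Context: Network: $G=(V,E)$ is a directed graph with $V=\{1,\dots,d\}$ ($d$ fixed) and incidence matrix $H$, where $H(i,j)=1$ if $(i,j)\in E$, $H(i,j)=0$ otherwise, and $H(i,i)=0$ for all $i$; $H$ is assumed irreducible. The matrix $A=(a_{ij})_{i,j\in V}$ satisfies $a_{ij}=0$ if $H(i,j)=0$, $a_{ij}>0$ if $H(i,j)=1$, and $\sum_{j=1}^d a_{ij}=1$ for every $i$. Supplies and demands: $T=\{t_1,\dots,t_d\}$ is the set of node locations; $\gamma,\mu,\sigma$ are fixed positive functions on $T$, and $\sigma^2(\cdot,\cdot)$ is a fixed function on $T\times T$ with $\sigma^2(t,t)=\sigma^2(t)$. The rarity parameter $n$ ranges over the positive integers. The node at location $t_i$ has deterministic supply $s_n(t_i)=n^\beta\gamma(t_i)$; put $\boldsymbol{s}_n=(s_n(t_1),\dots,s_n(t_d))'$. The demand vector $\boldsymbol{D}=(D(t_1),\dots,D(t_d))'$ does not depend on $n$ and is jointly Gaussian $N(\boldsymbol{\mu},\Sigma)$ with $\boldsymbol{\mu}=(\mu(t_1),\dots,\mu(t_d))'$ and $\Sigma_{ij}=\sigma^2(t_i,t_j)$, where $\Sigma$ is symmetric positive definite. (The model also assumes that each node's expected demand is at most its supply; here this holds automatically for all large $n$.) Polar representation: $\boldsymbol{D}=\boldsymbol{\mu}+RW\boldsymbol{\Psi}$, where $W$ is a $d\times d$ matrix with $WW^{T}=\Sigma$, the radius $R>0$ satisfies $R^2\sim\Gamma(d/2,1/2)$ (i.e. $R^2$ has density $x^{d/2-1}e^{-x/2}(1/2)^{d/2}/\Gamma(d/2)$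 on $(0,\infty)$), the angle $\boldsymbol{\Psi}$ is uniformly distributed on the unit sphere of $\mathbb{R}^d$, and $R$ and $\boldsymbol{\Psi}$ are independent. Thus for a unit vector $\boldsymbol{\psi}$, $T_n(\boldsymbol{\psi})=P\{L_n(\boldsymbol{\mu}+RW\boldsymbol{\psi})>k_n\}$. Dual linear program: $L_n(\boldsymbol{D})=\sup\{\boldsymbol{y}'(\boldsymbol{D}-\boldsymbol{s}_n):\ \boldsymbol{y}\in\mathbb{R}^d,\ (I-A)\boldsymbol{y}\le\boldsymbol{1},\ \boldsymbol{y}\ge\boldsymbol{0}\}\in[0,\infty]$, where $I$ is the identity matrix, inequalities are componentwise, $\boldsymbol{1}$ is the all-ones vector, and the value is $+\infty$ if the program is unbounded. Asymptotic optimality: a collection $(Z_n)$ of estimators for $\rho(n)$ is asymptotically optimal if $E[Z_n]=\rho(n)$ for all $n$ and $\sup_{n>0}\frac{E(Z_n^2)}{\rho(n)^{2-\epsilon}}<\infty$ for every $\epsilon>0$. $f(n)=o(g(n))$ means that for every $C>0$ there is $N$ such that $|f(n)|<C|g(n)|$ for all $n>N$; $f(n)=O(g(n))$ means $|f(n)|\le C|g(n)|$ for some constant $C$ and all sufficiently large $n$. *)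

(* Defs.v *)
From HB Require Import structures.
From mathcomp Require Import all_boot all_order all_algebra.
From mathcomp Require Import all_classical all_reals all_analysis.

Set Implicit Arguments.
Unset Strict Implicit.
Unset Printing Implicit Defensive.

Import Order.TTheory GRing.Theory Num.Theory.
Import numFieldNormedType.Exports.

Local Open Scope classical_set_scope.
Local Open Scope ring_scope.

(* Random vectors take their values in d.-tuple R, which carries the product
   sigma-algebra of R^d; colvec and tupvec pass to and from column vectors. *)
Definition colvec (R : realType) (d : nat) (x : d.-tuple R) : 'cV[R]_d :=
  \col_i tnth x i.

Definition tupvec (R : realType) (d : nat) (v : 'cV[R]_d) : d.-tuple R :=
  [tuple v i 0 | i < d].

(* The norm provided by the library on matrices is the sup norm. *)
Definition enorm (R : realType) (d : nat) (v : 'cV[R]_d) : R :=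
  Num.sqrt (\sum_(i < d) v i 0 ^+ 2).

Definition incidence_mx (R : realType) (d : nat) (E : rel 'I_d) : 'M[R]_d :=
  \matrix_(i, j) (E i j)%:R.

(* For a nonnegative matrix: every entry is positive in some positive power. *)
Definition irreducible_nneg_mx (R : realType) (d : nat) (H : 'M[R]_d) : Prop :=
  forall i j : 'I_d, exists2 m : nat, (0 < m)%N & 0 < (H ^+ m) i j.

Definition posdef_mx (R : realType) (d : nat) (S : 'M[R]_d) : Prop :=
  S^T = S /\ forall v : 'cV[R]_d, v != 0 -> 0 < (v^T *m S *m v) 0 0.

(* Nondegenerate case only (S positive definite): every nontrivial linear
   combination a'X is normal with mean a'm and variance a'Sa.  The second
   parameter of normal_prob is the standard deviation; the combination a = 0 is
   excluded because normal_prob _ 0 is not a point mass. *)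
Definition gaussian_law (R : realType) (d : nat)
    (nu : set (d.-tuple R) -> \bar R) (m : 'cV[R]_d) (S : 'M[R]_d) : Prop :=
  forall a : 'cV[R]_d, a != 0 ->
  forall B : set R, measurable B ->
    nu [set x | B ((a^T *m colvec x) 0 0)] =
    normal_prob ((a^T *m m) 0 0) (Num.sqrt ((a^T *m S *m a) 0 0)) B.

Definition Gamma_fun (R : realType) (a : R) : R :=
  \int[lebesgue_measure]_(x in `]0, +oo[) (x `^ (a - 1) * expR (- x)).

(* a is the shape and b the rate. *)
Definition gamma_pdf (R : realType) (a b x : R) : R :=
  if 0 < x then x `^ (a - 1) * expR (- (b * x)) * b `^ a / Gamma_fun a else 0.

Definition gamma_law (R : realType) (nu : set R -> \bar R) (a b : R) : Prop :=
  forall B : set R, measurable B ->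
    nu B = (\int[lebesgue_measure]_(x in B) (gamma_pdf a b x)%:E)%E.

(* The uniform distribution on the unit sphere is the probability carried by
   the sphere that is invariant under the orthogonal group. *)
Definition uniform_sphere_law (R : realType) (d : nat)
    (nu : set (d.-tuple R) -> \bar R) : Prop :=
  nu [set x | enorm (colvec x) = 1] = 1%E /\
  forall Q : 'M[R]_d, Q *m Q^T = 1%:M ->
  forall B : set (d.-tuple R), measurable B ->
    nu [set x | B (tupvec (Q *m colvec x))] = nu B.

Definition independent_RV (R : realType) (disp d1 d2 : measure_display)
    (Omega : measurableType disp) (P : probability Omega R)
    (T1 : measurableType d1) (T2 : measurableType d2)
    (X : Omega -> T1) (Y : Omega -> T2) : Prop :=
  forall (B1 : set T1) (B2 : set T2), measurable B1 -> measurable B2 ->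
    P (X @^-1` B1 `&` Y @^-1` B2) = (P (X @^-1` B1) * P (Y @^-1` B2))%E.

Definition dual_feasible (R : realType) (d : nat) (A : 'M[R]_d) :
    set 'cV[R]_d :=
  [set y | (forall i, ((1%:M - A) *m y) i 0 <= 1) /\ forall i, 0 <= y i 0].

(* Since y = 0 is feasible, the value lies in [0, +oo]. *)
Definition dual_value (R : realType) (d : nat) (A : 'M[R]_d)
    (s D : 'cV[R]_d) : \bar R :=
  ereal_sup [set ((y^T *m (D - s)) 0 0)%:E | y in dual_feasible A].

Definition polar_demand (R : realType) (d : nat) (m : 'cV[R]_d)
    (W : 'M[R]_d) (r : R) (psi : 'cV[R]_d) : 'cV[R]_d :=
  m + r *: (W *m psi).

(* T(psi) = P{L(m + rad W psi) > c}; as rad and Psi are independent, T(Psi) is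
   the conditional probability P{L(D) > c | Psi}. *)
Definition conditional_tail (R : realType) (disp : measure_display)
    (Omega : measurableType disp) (P : probability Omega R) (d : nat)
    (A : 'M[R]_d) (s m : 'cV[R]_d) (W : 'M[R]_d) (rad : Omega -> R) (c : R)
    (psi : 'cV[R]_d) : \bar R :=
  P [set w | (c%:E < dual_value A s (polar_demand m W (rad w) psi))%E].

(* The index n ranges over the positive integers.  The first two clauses say
   that Z n is a random variable and that the ratios have positive
   denominators. *)
Definition asymptotically_optimal (R : realType) (disp : measure_display)
    (Omega : measurableType disp) (P : probability Omega R)
    (Z : nat -> Omega -> R) (rho : nat -> R) : Prop :=
  [/\ forall n, (0 < n)%N -> measurable_fun setT (Z n),
      forall n, (0 < n)%N -> 0 < rho n,
      forall n, (0 < n)%N -> ('E_P[Z n] = (rho n)%:E)%E &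
      forall eps : R, 0 < eps ->
        (ereal_sup [set 'E_P[(fun w => (Z n w) ^+ 2)%R] *
                        ((rho n `^ (2 - eps))^-1)%:E
                    | n in [set n | (0 < n)%N]] < +oo)%E].

(* Main.v *)
Require Import Defs.
From HB Require Import structures.
From mathcomp Require Import all_boot all_order all_algebra.
From mathcomp Require Import all_classical all_reals all_analysis.
From mathcomp Require Import measurable_realfun ring lra.

Set Implicit Arguments.
Unset Strict Implicit.
Unset Printing Implicit Defensive.

Import Order.TTheory GRing.Theory Num.Theory.
Import numFieldNormedType.Exports.

Local Open Scope classical_set_scope.
Local Open Scope ring_scope.

(* Feasible dual vectors are nonnegative and include the unit vectors, so
   L(D) > c >= 0 forces D_i > s_i for some i, while D_i > s_i + c already gives
   L(D) > c.  With s0 = min_i gamma_i / sigma_i, Cauchy-Schwarz turns the first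
   fact into T_n(psi) <= P(R > n^beta s0 - C) for every unit vector psi, and the
   second bounds alpha_n from below by a one-dimensional normal tail.  Both
   bounds are exp(-(n^beta s0)^2 / 2 * (1 + o(1))) because k_n = o(n^beta), which
   gives asymptotic optimality.  Unbiasedness is Fubini's theorem; the events are
   measurable since the supremum may be taken over rational feasible vectors. *)

(** * Exceedance events of the dual program *)

Lemma dual_value_gtP (R : realType) (d : nat) (A : 'M[R]_d) (s D : 'cV[R]_d)
    (c : R) :
  (c%:E < dual_value A s D)%E <->
  exists2 y, dual_feasible A y & c < (y^T *m (D - s)) 0 0.
Proof.
split=> [/ereal_sup_gt[_ [y fy <-]]|[y fy cy]]; first by rewrite lte_fin; exists y.
by rewrite (@lt_le_trans _ _ ((y^T *m (D - s)) 0 0)%:E) ?lte_fin//; apply: ereal_sup_ubound; exists y.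
Qed.

(** The unit vector at [i] is feasible: the entries of [(I - A) e_i] are at most 1 because [A] is
    nonnegative. Its objective value is the shortage at node [i]. *)
Lemma dual_value_ge_shortage (R : realType) (d : nat) (A : 'M[R]_d)
    (s D : 'cV[R]_d) (i : 'I_d) (c : R) :
  (forall i j, 0 <= A i j) -> s i 0 + c < D i 0 ->
  (c%:E < dual_value A s D)%E.
Proof.
move=> A0 sD; apply/dual_value_gtP; exists (delta_mx i 0).
  split=> j; last by rewrite mxE; case: eqP.
  rewrite mulmxBl mul1mx -colE !mxE (le_trans (y := (j == i)%:R))//.
    by rewrite eqxx andbT gerBl.
  by case: eqP.
by rewrite trmx_delta -rowE !mxE ltrBrDl.
Qed.

(** If [D <= s] at every node, then nonnegativity of [y] makes every objective value at most 0. *)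
Lemma dual_value_gt0_shortage (R : realType) (d : nat) (A : 'M[R]_d)
    (s D : 'cV[R]_d) (c : R) :
  0 <= c -> (c%:E < dual_value A s D)%E -> exists i, s i 0 < D i 0.
Proof.
move=> c0 /dual_value_gtP[y [_ y0]] /(le_lt_trans c0); rewrite ltNge => yD.
apply/existsP; rewrite -[X in is_true X]negbK negb_exists; apply: contra yD.
move=> /forallP Ds; rewrite mxE; apply: sumr_le0 => i _.
by rewrite !mxE mulr_ge0_le0// subr_le0 leNgt; exact: Ds.
Qed.

(** Replaces the supremum by a countable family, for measurability. A feasible [y] with value above
    [c] is scaled by [1 - e] and then rounded to rationals, the rounding error being absorbed by the
    slack so created. *)
Lemma dual_value_gt_ratP (R : realType) (d : nat) (A : 'M[R]_d)
    (s D : 'cV[R]_d) (c : R) :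
  (c%:E < dual_value A s D)%E <->
  exists2 q : {ffun 'I_d -> rat}, dual_feasible A (\col_i ratr (q i)) &
    c < ((\col_i ratr (q i))^T *m (D - s)) 0 0.
Proof.
split=> [|[q fq cq]]; last by apply/dual_value_gtP; exists (\col_i ratr (q i)).
move=> /dual_value_gtP[y [yA y0]] cy.
set f := (y^T *m (D - s)) 0 0 in cy.
set g := fun i => (D - s) i 0.
have fE : f = \sum_i y i 0 * g i by rewrite /f mxE; apply: eq_bigr => i _; rewrite mxE.
(* Shrinking y towards 0 makes the constraints strict, leaving room to round. *)
pose e := (f - c) / (1 + (f - c) + `|f|).
have dpos : 0 < 1 + (f - c) + `|f| by have := normr_ge0 f; lra.
have e0 : 0 < e by rewrite divr_gt0// subr_gt0.
have e1 : e < 1 by rewrite /e ltr_pdivrMr//; have := normr_ge0 f; lra.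
have ef : 0 < (1 - e) * f - c.
  have eE : e * (1 + (f - c) + `|f|) = f - c by rewrite /e divfK// gt_eqF.
  have := ler_norm f; have := normr_ge0 f; nra.
(* [M] strictly dominates the absolute row sums of [I - A] and the sum of the [|g i|], so errors of
   at most [del] per coordinate move each constraint and the objective by less than [del * M]. *)
pose M := 1 + \sum_i `|g i| + \sum_i \sum_j `|(1%:M - A) i j|.
have M0 : 0 < M.
  rewrite /M -addrA ltr_pwDl//; apply: addr_ge0; apply: sumr_ge0 => i _//.
  exact: sumr_ge0.
have gM : \sum_i `|g i| < M.
  rewrite /M (addrC 1) -addrA ltrDl ltr_pwDl//.
  by apply: sumr_ge0 => i _; exact: sumr_ge0.
have AM i : \sum_j `|(1%:M - A) i j| < M.
  have : \sum_j `|(1%:M - A) i j| <= \sum_i \sum_j `|(1%:M - A) i j|.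
    by rewrite [leRHS](bigD1 i)//= lerDl; apply: sumr_ge0 => k _; exact: sumr_ge0.
  by rewrite /M; have : 0 <= \sum_i `|g i| by [exact: sumr_ge0]; lra.
pose del := Num.min e ((1 - e) * f - c) / M.
have del0 : 0 < del by rewrite divr_gt0// lt_min e0 ef.
have delM : del * M <= e /\ del * M <= (1 - e) * f - c.
  by rewrite /del divfK ?gt_eqF// !ge_min !lexx orbT.
(* Rounding goes upwards, which preserves nonnegativity. *)
have /choice[q qP] (i : 'I_d) : exists q : rat,
    0 <= ratr q - (1 - e) * y i 0 <= del.
  have /rat_in_itvoo[q] : (1 - e) * y i 0 < (1 - e) * y i 0 + del by rewrite ltrDl.
  by rewrite in_itv/= => /andP[q1 q2]; exists q; apply/andP; split; lra.
have hb (h : 'I_d -> R) :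
    `|\sum_i h i * (ratr (q i) - (1 - e) * y i 0)| <= del * \sum_i `|h i|.
  rewrite (le_trans (ler_norm_sum _ _ _))// mulr_sumr ler_sum// => i _.
  have /andP[q1 q2] := qP i.
  by rewrite normrM mulrC ler_wpM2r// ger0_norm.
exists [ffun i => q i].
  split=> i; last first.
    rewrite mxE ffunE; have /andP[q1 _] := qP i.
    by have := y0 i; have := e1; nra.
  have := hb (fun j => (1%:M - A) i j).
  have := yA i; rewrite !mxE.
  have -> : \sum_j (1%:M - A) i j * (ratr (q j) - (1 - e) * y j 0) =
     \sum_j (1%:M - A) i j * ratr (q j) - (1 - e) * \sum_j (1%:M - A) i j * y j 0.
    by rewrite mulr_sumr -sumrB; apply: eq_bigr => j _; ring.
  have -> : \sum_j (1%:M - A) i j * (\col_i0 ratr ([ffun i1 => q i1] i0)) j 0 =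
     \sum_j (1%:M - A) i j * ratr (q j) :> R.
    by apply: eq_bigr => j _; rewrite mxE ffunE.
  set v := \sum_j _; set u := \sum_j _ => v1 /ler_normlP[_ uv].
  have /ltW := AM i; have [dM _] := delM.
  set w := \sum_j _ in uv * => wM.
  have : del * w <= e by rewrite (le_trans _ dM)// ler_wpM2l// ltW.
  by have : (1 - e) * v <= 1 - e by [rewrite ler_piMr// subr_ge0 ltW]; lra.
have := hb g.
have -> : \sum_i g i * (ratr (q i) - (1 - e) * y i 0) =
   ((\col_i ratr ([ffun i => q i] i))^T *m (D - s)) 0 0 - (1 - e) * f.
  rewrite fE mulr_sumr mxE -sumrB; apply: eq_bigr => i _.
  by rewrite !mxE ffunE /g !mxE; ring.
set u := (_ *m _) 0 0; move=> /ler_normlP[uf _].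
have [_ dM] := delM.
by have : del * \sum_i `|g i| < del * M by [rewrite ltr_pM2l]; lra.
Qed.

(** * Measurability, and conditioning on the angle *)

(** A countable union over rational [q]; for each feasible [q] the event is a superlevel set of a
    polynomial in the radius and the coordinates of the angle. *)
Lemma measurable_dual_value_gt (R : realType) (d : nat) (A W : 'M[R]_d)
    (s m : 'cV[R]_d) (c : R) :
  measurable [set x : d.-tuple R * R |
    (c%:E < dual_value A s (polar_demand m W x.2 (colvec x.1)))%E].
Proof.
have -> : [set x : d.-tuple R * R |
    (c%:E < dual_value A s (polar_demand m W x.2 (colvec x.1)))%E] =
  \bigcup_(q : {ffun 'I_d -> rat}) [set x : d.-tuple R * R |
    dual_feasible A (\col_i ratr (q i)) /\
    c < ((\col_i ratr (q i))^T *m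
          (polar_demand m W x.2 (colvec x.1) - s)) 0 0].
  apply/seteqP; split=> x /=; first by move=> /dual_value_gt_ratP[q fq cq]; exists q.
  by move=> [q _ [fq cq]]; apply/dual_value_gt_ratP; exists q.
apply: countable_bigcupT_measurable; first exact: countableP.
move=> q; have [fq|nfq] := pselect (dual_feasible A (\col_i ratr (q i))); last first.
  by rewrite (_ : [set _ | _] = set0)//; apply/seteqP; split=> // x [].
pose f (x : d.-tuple R * R) : R := \sum_i ratr (q i) *
  (m i 0 + x.2 * (\sum_j W i j * tnth x.1 j) - s i 0).
rewrite (_ : [set _ | _] = setT `&` f @^-1` `]c, +oo[).
  have mf : measurable_fun setT f.
    apply: measurable_sum => i; apply: measurable_funM => //.
    apply: measurable_funB => //; apply: measurable_funD => //.
    apply: measurable_funM => //; apply: measurable_sum => j.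
    apply: measurable_funM => //.
    by apply: (measurableT_comp (measurable_tnth j)).
  by apply: mf => //; exact: measurable_itv.
rewrite setTI; apply/seteqP; split=> x /=; rewrite in_itv/= andbT.
  move=> [_]; rewrite mxE (_ : \sum_i _ = f x)//.
  apply: eq_bigr => i _; rewrite !mxE; congr (_ * (_ + _ * _ - _)).
  by apply: eq_bigr => j _; rewrite mxE.
move=> cf; split=> //; rewrite mxE (_ : \sum_i _ = f x)//.
apply: eq_bigr => i _; rewrite !mxE; congr (_ * (_ + _ * _ - _)).
by apply: eq_bigr => j _; rewrite mxE.
Qed.

(** By independence the joint law of [(Y, X)] agrees with the product measure on rectangles, hence
    everywhere; the left side is the product measure of [S] computed by sections. *)
Lemma independent_RV_joint (R : realType) (disp d1 d2 : measure_display)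
    (Omega : measurableType disp) (P : probability Omega R)
    (T1 : measurableType d1) (T2 : measurableType d2)
    (X : {RV P >-> T1}) (Y : {RV P >-> T2}) (S : set (T2 * T1)) :
  independent_RV P X Y -> measurable S ->
  (\int[P]_w P [set w' | S (Y w, X w')] = P [set w | S (Y w, X w)])%E.
Proof.
move=> indep mS.
pose Z w := (Y w, X w).
have mZ : measurable_fun setT Z.
  by apply: measurable_fun_pair; exact: measurable_funPT.
pose Zm := [the {mfun _ >-> _} of mfun_Sub (mem_set mZ : Z \in mfun)].
transitivity (distribution P Zm S); last by [].
rewrite -(@product_measure_unique _ _ _ _ _ (distribution P Y) (distribution P X) (distribution P Zm))//.
  rewrite /product_measure1 ge0_integral_distribution//; last first.
    exact: measurable_fun_xsection.
  apply: eq_integral => w _ /=; rewrite /distribution/= /pushforward/=.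
  by congr (P _); apply/seteqP; split=> w'/=; rewrite /xsection/= ?inE.
move=> B1 B2 mB1 mB2; rewrite muleC -indep//.
by rewrite /distribution/= /pushforward/=; congr (P _); apply/seteqP; split=> w [].
Qed.

(** * Tail estimates and elementary inequalities *)

(** With an integer [N >= a], [N > 0], write [y ^ N] as [(N / e) ^ N] times [(e * y / N) ^ N] and
    use [x <= expR x]. *)
Lemma powR_le_expR (R : realType) (a e : R) : 0 < e ->
  exists2 K, 0 < K & forall y, 1 <= y -> y `^ a <= K * expR (e * y).
Proof.
move=> e0; pose N := (Num.bound `|a|).+1.
have aN : a <= N%:R.
  rewrite (le_trans (ler_norm a))// (le_trans (ltW (archi_boundP _)))//.
  by rewrite ler_nat.
have N0 : 0 < N%:R :> R by rewrite ltr0n.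
exists ((N%:R / e) ^+ N); first by rewrite exprn_gt0// divr_gt0.
move=> y y1; rewrite (le_trans (ler_powR y1 aN))// powR_mulrn; last by lra.
have -> : expR (e * y) = expR (e * y / N%:R) ^+ N.
  by rewrite -expRM_natr divfK// gt_eqF.
rewrite -exprMn; apply: lerXn2r; rewrite ?nnegrE.
- by lra.
- by rewrite mulr_ge0 ?expR_ge0// divr_ge0 ?ltW.
have {1}-> : y = N%:R / e * (e * y / N%:R).
  by field; rewrite !gt_eqF.
rewrite ler_pM2l ?divr_gt0// (le_trans _ (expR_ge1Dx _))//.
by rewrite lerDr.
Qed.

(** Write [b = c + 2e]: one [e] absorbs the power of [y], the other leaves an integrable exponential
    density, and [c] gives the decay in [x]. *)
Lemma gamma_law_tail (R : realType) (nu : set R -> \bar R) (a b c : R) :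
  gamma_law nu a b -> 0 <= c -> c < b ->
  exists2 K, 0 < K &
    forall x, 1 <= x -> (nu `]x, +oo[%classic <= (K * expR (- (c * x)))%:E)%E.
Proof.
move=> nuE c0; rewrite -subr_gt0 => cb; pose e := (b - c) / 2.
have e0 : 0 < e by rewrite divr_gt0.
have [K K0 hK] := powR_le_expR (a - 1) e0.
pose G := b `^ a / Gamma_fun a.
have Gam0 : 0 <= Gamma_fun a.
  by apply: Rintegral_ge0 => x _; rewrite mulr_ge0 ?powR_ge0 ?expR_ge0.
have G0 : 0 <= G by rewrite divr_ge0 ?powR_ge0.
have KG0 : 0 <= K * G / e by rewrite divr_ge0 ?(ltW e0)// mulr_ge0 ?(ltW K0).
(* The summand 1 makes the constant positive, since [G] is only known to be nonnegative. *)
exists (K * G / e + 1); first by rewrite ltr_wpDl.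
move=> x x1; rewrite nuE; last exact: measurable_itv.
pose h y : R := K * G / e * expR (- (c * x)) * exponential_pdf e y.
have mh : measurable_fun setT h.
  by apply: measurable_funM => //; exact: measurable_exponential_pdf.
have h0 y : 0 <= h y.
  rewrite /h mulr_ge0 ?exponential_pdf_ge0 ?(ltW e0)//.
  by rewrite mulr_ge0 ?expR_ge0.
apply: (@le_trans _ _ (\int[lebesgue_measure]_y (h y)%:E)%E).
  apply: (@le_trans _ _ (\int[lebesgue_measure]_(y in `]x, +oo[) (h y)%:E)%E).
    apply: ge0_le_integral.
    - exact: measurable_itv.
    - move=> y _; rewrite lee_fin /gamma_pdf; case: ifP => // _.
      by rewrite divr_ge0// !mulr_ge0 ?powR_ge0 ?expR_ge0.
    - apply/measurable_EFinP; apply: measurable_funTS.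
      apply: measurable_fun_ifT => //.
        exact: measurable_fun_ltr.
      apply: measurable_funM => //; apply: measurable_funM => //.
      apply: measurable_funM; first exact: measurable_powR.
      apply: measurableT_comp; first exact: measurable_expR.
      by apply: measurableT_comp => //; exact: measurable_funM.
    - by apply/measurable_EFinP; exact: measurable_funTS.
    move=> y /=; rewrite in_itv/= andbT => xy; rewrite lee_fin /gamma_pdf.
    have y1 : 1 <= y by rewrite (le_trans x1)// ltW.
    have y0 : 0 < y by lra.
    rewrite y0 /h exponential_pdfE; last exact: ltW.
    rewrite -[X in _ <= X](_ : K * expR (- (c * x)) * expR (- e * y) * G = _); last first.
      by field; rewrite gt_eqF.
    rewrite -mulrA ler_wpM2r//.
    rewrite (@le_trans _ _ (K * expR (e * y) * expR (- (b * y))))//.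
      by rewrite ler_wpM2r ?expR_ge0// hK.
    rewrite -!mulrA ler_pM2l// -!expRD ler_expR.
    have -> : b = c + e + e by rewrite /e; field.
    by have : c * x <= c * y by [rewrite ler_wpM2l// ltW]; nra.
  apply: ge0_subset_integral => //.
  - by apply/measurable_EFinP.
  - by move=> y _; rewrite lee_fin.
under eq_integral do rewrite EFinM.
rewrite ge0_integralZl//; last 3 first.
- by apply/measurable_EFinP; exact: measurable_exponential_pdf.
- by move=> y _; rewrite lee_fin exponential_pdf_ge0// ltW.
- by rewrite lee_fin mulr_ge0 ?expR_ge0.
rewrite integral_exponential_pdf// mule1 lee_fin ler_wpM2r ?expR_ge0//.
by rewrite lerDl.
Qed.

(** Integrates over []u, u + 1]] only, an interval of length 1 whose points lie within [u + 1 + m]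
    of the mean. *)
Lemma normal_prob_tail_ge (R : realType) (m s u : R) : s != 0 -> 0 <= m -> 0 <= u ->
  ((normal_peak s * expR (- (u + 1 + m) ^+ 2 / (s ^+ 2 *+ 2)))%:E <=
   normal_prob m s `]u, +oo[%classic)%E.
Proof.
move=> s0 m0 u0; rewrite /normal_prob; set c := (_ * _)%R.
have mI : measurable (`]u, u + 1] : set R) by exact: measurable_itv.
have mp : measurable_fun setT (fun x => (normal_pdf m s x)%:E).
  by apply/measurable_EFinP; exact: measurable_normal_pdf.
apply: (@le_trans _ _ (\int[lebesgue_measure]_(x in `]u, (u + 1)%R]) (normal_pdf m s x)%:E)%E).
  have -> : c%:E = (\int[lebesgue_measure]_(x in `]u, (u + 1)%R]) (cst c%:E) x)%E.
    rewrite integral_cst//= lebesgue_measure_itv/= lte_fin ltrDl ltr01.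
    by rewrite -EFinD addrAC subrr add0r mule1.
  apply: ge0_le_integral => //.
  - by move=> x _; rewrite lee_fin mulr_ge0 ?normal_peak_ge0 ?expR_ge0.
  - exact: measurable_funTS.
  move=> x /=; rewrite in_itv/= => /andP[ux xu]; rewrite lee_fin.
  rewrite normal_pdfE//= ler_wpM2l ?normal_peak_ge0// ler_expR.
  rewrite ler_wpM2r ?invr_ge0 ?mulrn_wge0 ?sqr_ge0// lerN2.
  by nra.
apply: ge0_subset_integral => //.
- exact: measurable_funTS.
- by move=> x _; rewrite lee_fin normal_pdf_ge0.
by move=> x /=; rewrite !in_itv/= andbT => /andP[].
Qed.

(** Row [i] of [W] has Euclidean norm [sd], so the [i]-th entry of [W psi] is at most [sd] by
    Cauchy-Schwarz, obtained here by expanding a sum of squares. *)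
Lemma polar_demand_radius_gt (R : realType) (d : nat) (W : 'M[R]_d)
    (m psi : 'cV[R]_d) (i : 'I_d) (sd s r : R) :
  0 < sd -> (W *m W^T) i i = sd ^+ 2 -> enorm psi = 1 -> 0 < r ->
  s < polar_demand m W r psi i 0 -> (s - m i 0) / sd < r.
Proof.
move=> sd0 WW psi1 r0; rewrite !mxE => sr.
have psiE : \sum_j psi j 0 ^+ 2 = 1.
  rewrite -(sqr_sqrtr (a := \sum_j psi j 0 ^+ 2)) -/(enorm psi) ?psi1 ?expr1n//.
  by apply: sumr_ge0 => j _; exact: sqr_ge0.
have WE : \sum_j W i j ^+ 2 = sd ^+ 2.
  by rewrite -WW mxE; apply: eq_bigr => j _; rewrite mxE expr2.
have : 0 <= \sum_j (W i j - sd * psi j 0) ^+ 2.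
  by apply: sumr_ge0 => j _; exact: sqr_ge0.
have -> : \sum_j (W i j - sd * psi j 0) ^+ 2 =
    \sum_j W i j ^+ 2 + sd ^+ 2 * \sum_j psi j 0 ^+ 2 -
    2 * sd * \sum_j W i j * psi j 0.
  by rewrite !mulr_sumr -big_split -sumrB; apply: eq_bigr => j _/=; ring.
rewrite psiE WE; set u := \sum_j _ in sr *.
move=> sdu; have {}sdu : u <= sd by nra.
by rewrite ltr_pdivrMr//; nra.
Qed.

Lemma powR_nat_ge (R : realType) (b x : R) : 0 < b ->
  \forall n \near \oo, x <= n%:R `^ b.
Proof.
move=> b0; exists (Num.bound (`|x| `^ b^-1)) => // n /= xn.
rewrite (le_trans (ler_norm x))//.
rewrite (_ : `|x| = (`|x| `^ b^-1) `^ b); last first.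
  by rewrite -powRrM mulVf ?gt_eqF// powRr1.
apply: ge0_ler_powR; rewrite ?nnegrE ?powR_ge0 ?ler0n ?(ltW b0)//.
by rewrite (le_trans (ltW (archi_boundP _))) ?powR_ge0 ?ler_nat.
Qed.

(** * Comparison of the radial tail [p] with the lower bound for [a]; [m n] stands for [n] to the
    power [beta] *)

Section tail_comparison.
Context (R : realType) (p : R -> R) (a m h : nat -> R) (c0 s0 C : R).
Hypothesis c0_gt0 : 0 < c0.
Hypothesis s0_gt0 : 0 < s0.
Hypothesis C_ge0 : 0 <= C.
Hypothesis m_ge0 : forall n, 0 <= m n.
Hypothesis h_ge0 : forall n, (0 < n)%N -> 0 <= h n.
Hypothesis p_ge0 : forall r, 0 <= p r.
Hypothesis p_tail : forall c, 0 <= c -> c < 1 / 2 ->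
  exists2 K, 0 < K & forall r, 1 <= r -> p r <= K * expR (- (c * r ^+ 2)).
Hypothesis a_ge : forall n, (0 < n)%N ->
  c0 * expR (- ((m n * s0 + h n) ^+ 2 / 2)) <= a n.
Hypothesis h_o : forall x e, 0 < e -> \forall n \near \oo, x + h n <= e * m n.

(** Put [q = m n * s0]. Eventually [h n <= q / 2], so [a n] is at least [c0 * expR (- 9/8 q^2)],
    whereas the tail exponent 1/4 at radius [3 q] gives at most [K * expR (- 9/4 q^2)]. *)
Lemma tail_le_lower_bound : exists n0 c3, [/\ (0 < n0)%N, 0 < c3 &
  forall n, (n0 < n)%N -> c3 * p (m n * (3 * s0)) <= a n].
Proof.
have [K K0 pK] := @p_tail (1 / 4) ltac:(lra) ltac:(lra).
have [|N _ hN] := @h_o 1 (s0 / 2); first by rewrite divr_gt0.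
exists N.+1, (c0 / K); split=> //; first by rewrite divr_gt0.
move=> n Nn; have /= hn := hN n (ltnW (ltnW Nn)).
have n0 : (0 < n)%N by exact: leq_trans Nn.
have hn0 := h_ge0 n0.
have m1 : 2 <= m n * s0 by have : 1 <= s0 / 2 * m n; lra.
rewrite (le_trans _ (a_ge n0))// mulrAC -mulrA ler_pM2l//.
rewrite ler_pdivrMr// [leRHS]mulrC (le_trans (pK _ _)) ?ler_pM2l//; first by lra.
rewrite ler_expR lerN2 ler_pdivrMr//.
have : (m n * s0 + h n) ^+ 2 <= (3 / 2 * (m n * s0)) ^+ 2.
  by rewrite lerXn2r ?nnegrE; lra.
by nra.
Qed.

Lemma sqr_tail_le_powR (e : R) : 0 < e -> e <= 1 ->
  exists2 B, 0 <= B & \forall n \near \oo,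
    p (m n * s0 - C) ^+ 2 <= B * a n `^ (2 - e).
Proof.
(* With [q = m n * s0], the left side decays at least like [(1 - t)^3 q^2] and the right side at
   most like [(1 + t)^2 (1 - e/2) q^2] in the exponent. For [e = 10 t] the first-order terms in [t]
   agree, and the difference [12 t^2 + 4 t^3] has the right sign. *)
move=> e0 e1; have [t tE] : exists t, e = 10 * t by exists (e / 10); field.
have t0 : 0 < t by lra.
have t1 : t <= 1 / 10 by lra.
have [K K0 pK] := @p_tail ((1 - t) / 2) ltac:(lra) ltac:(lra).
exists (K ^+ 2 / c0 `^ (2 - e)).
  by rewrite divr_ge0 ?powR_ge0 ?sqr_ge0.
(* One inequality serves both sides: it yields [q - C >= (1 - t) q] and [q + h n <= (1 + t) q]. *)
have [|N _ hN] := @h_o (C + 1) (t * s0); first by rewrite mulr_gt0.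
exists N.+1 => // n /= Nn; have /= hn := hN n (ltnW Nn).
have n0 : (0 < n)%N by exact: leq_trans Nn.
have hn0 := h_ge0 n0; have C0 := C_ge0.
have := m_ge0 n; rewrite -(pmulr_lge0 _ s0_gt0); have := a_ge n0.
have hq : C + 1 + h n <= t * (m n * s0) by lra.
move: (m n * s0) hq => q hq an q0.
have q10 : 10 <= q.
  have : t * q <= 1 / 10 * q by rewrite ler_wpM2r.
  by lra.
have tq : t * q <= 1 / 10 * q by rewrite ler_wpM2r//; lra.
have pq : p (q - C) ^+ 2 <= K ^+ 2 * expR (- ((1 - t) ^+ 3 * q ^+ 2)).
  have -> : - ((1 - t) ^+ 3 * q ^+ 2) =
      2%:R * - ((1 - t) / 2 * ((1 - t) * q) ^+ 2) by field.
  rewrite expRM_natl -exprMn lerXn2r ?nnegrE//.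
    by rewrite mulr_ge0 ?expR_ge0// ltW.
  rewrite (le_trans (pK _ _))//; first by lra.
  rewrite ler_pM2l// ler_expR lerN2 ler_wpM2l//; first by lra.
  by rewrite lerXn2r ?nnegrE; lra.
have aq : c0 `^ (2 - e) * expR (- ((1 - t) ^+ 3 * q ^+ 2)) <= a n `^ (2 - e).
  apply: (@le_trans _ _ ((c0 * expR (- ((q + h n) ^+ 2 / 2))) `^ (2 - e))).
    rewrite powRM ?expR_ge0 ?(ltW c0_gt0)// ler_pM2l ?powR_gt0//.
    rewrite -expRM ler_expR mulNr lerN2.
    apply: (@le_trans _ _ (((1 + t) * q) ^+ 2 * ((2 - e) / 2))).
      by rewrite mulrAC -mulrA ler_wpM2r ?lerXn2r ?nnegrE; lra.
    have -> : (2 - e) / 2 = 1 - 5 * t by rewrite tE; field.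
    rewrite exprMn mulrAC ler_wpM2r ?sqr_ge0//.
    have : 0 <= t ^+ 2 by exact: sqr_ge0.
    have : 0 <= t ^+ 3 by rewrite exprn_ge0// ltW.
    by rewrite !exprS expr0; nra.
  have ce : 0 <= c0 * expR (- ((q + h n) ^+ 2 / 2)).
    by rewrite mulr_ge0 ?expR_ge0// ltW.
  by apply: ge0_ler_powR; rewrite ?nnegrE ?(le_trans ce an)//; lra.
rewrite (le_trans pq)// -mulrA ler_pM2l ?exprn_gt0//.
by rewrite [leRHS]mulrC ler_pdivlMr ?powR_gt0// [leLHS]mulrC.
Qed.

End tail_comparison.

(** * Gaussian marginals and a criterion for asymptotic optimality *)

Lemma gaussian_law_coord (R : realType) (d : nat)
    (nu : set (d.-tuple R) -> \bar R) (m : 'cV[R]_d) (S : 'M[R]_d)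
    (i : 'I_d) (B : set R) :
  gaussian_law nu m S -> measurable B ->
  nu [set x | B (tnth x i)] = normal_prob (m i 0) (Num.sqrt (S i i)) B.
Proof.
move=> nuE mB; have e0 : delta_mx i 0 != 0 :> 'cV[R]_d.
  by apply/eqP => /matrixP/(_ i 0)/eqP; rewrite !mxE !eqxx oner_eq0.
have := nuE _ e0 _ mB; rewrite trmx_delta -mulmxA -colE -!rowE !mxE => <-.
by congr nu; apply/seteqP; split=> x/=; rewrite -rowE !mxE.
Qed.

(** The second moment is at most [q n ^+ 2]. The asymptotic hypothesis handles all large [n]; the
    finitely many remaining ratios are finite because [rho n > 0]. *)
Lemma asymptotically_optimal_of_sqr_bound (R : realType)
    (disp : measure_display) (Omega : measurableType disp)
    (P : probability Omega R) (Z : nat -> Omega -> R) (rho q : nat -> R) :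
  (forall n, (0 < n)%N -> measurable_fun setT (Z n)) ->
  (forall n w, (0 < n)%N -> 0 <= Z n w) ->
  (forall n, (0 < n)%N -> 0 < rho n <= 1) ->
  (forall n, (0 < n)%N -> ('E_P[Z n] = (rho n)%:E)%E) ->
  (forall n, (0 < n)%N -> 0 <= q n <= 1) ->
  (forall n, (0 < n)%N -> {ae P, forall w, Z n w <= q n}) ->
  (forall e, 0 < e -> e <= 1 -> exists2 B, 0 <= B & \forall n \near \oo,
     q n ^+ 2 <= B * rho n `^ (2 - e)) ->
  asymptotically_optimal P Z rho.
Proof.
move=> mZ Z0 rho01 EZ q01 Zq qB; split=> // [n /rho01/andP[]//|eps eps0].
(* As [rho n <= 1], the bound for a smaller exponent loss implies the one for [eps]. *)
pose e := Num.min eps 1.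
have e0 : 0 < e by rewrite lt_min eps0 ltr01.
have [||B B0 [N _ hN]] := qB e => //; first by rewrite ge_min lexx orbT.
(* For [n < N] the ratio is at most its own term of this sum, since [q n <= 1]. *)
pose M := B + \sum_(i < N) (rho i `^ (2 - eps))^-1.
apply: (@le_lt_trans _ _ M%:E); last exact: ltry.
apply: ge_ereal_sup => _ [n /= n0 <-].
have [r0 r1] := andP (rho01 n n0); have [q0 q1] := andP (q01 n n0).
have rp0 : 0 < rho n `^ (2 - eps) by exact: powR_gt0.
have EZq : ('E_P[(fun w => Z n w ^+ 2)%R] <= (q n ^+ 2)%:E)%E.
  rewrite -(expectation_cst P); apply: expectation_le => //.
  - by apply: measurable_funX; exact: mZ.
  - by move=> w; exact: sqr_ge0.
  - by move=> w; exact: sqr_ge0.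
  apply: filterS (Zq n n0) => w Zqw.
  by rewrite lerXn2r ?nnegrE ?Z0.
apply: (@le_trans _ _ ((q n ^+ 2)%:E * ((rho n `^ (2 - eps))^-1)%:E)%E).
  by rewrite lee_wpmul2r// lee_fin invr_ge0 ltW.
rewrite -EFinM lee_fin; have [Nn|nN] := leqP N n.
  rewrite ler_pdivrMr// (le_trans (hN n Nn))//.
  apply: (@le_trans _ _ (B * rho n `^ (2 - eps))).
    rewrite ler_wpM2l// ger_powR ?r0// lerD2l lerN2.
    by rewrite /e ge_min lexx.
  rewrite ler_wpM2r ?(ltW rp0)// lerDl; apply: sumr_ge0 => i _.
  by rewrite invr_ge0 powR_ge0.
rewrite (@le_trans _ _ (rho n `^ (2 - eps))^-1)//.
  by rewrite ler_piMl ?invr_ge0 ?(ltW rp0)// expr_le1.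
rewrite /M (bigD1 (Ordinal nN))//= addrCA lerDl addr_ge0//.
by apply: sumr_ge0 => i _; rewrite invr_ge0 powR_ge0.
Qed.

(** * Application to the Gaussian demand model *)

Theorem theorem6 (R : realType) (d : nat) (d_gt0 : (0 < d)%N)
  (* network *)
  (E : rel 'I_d) (E_irr : forall i, ~~ E i i)
  (H_irr : irreducible_nneg_mx (incidence_mx R E))
  (A : 'M[R]_d)
  (A_pos : forall i j, E i j -> 0 < A i j)
  (A_zero : forall i j, ~~ E i j -> A i j = 0)
  (A_sum : forall i, \sum_j A i j = 1)
  (* locations, supplies and demand parameters *)
  (Loc : Type) (t : 'I_d -> Loc)
  (gamma mu sigma : Loc -> R) (sigma2 : Loc -> Loc -> R)
  (gamma_gt0 : forall i, 0 < gamma (t i))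
  (mu_gt0 : forall i, 0 < mu (t i))
  (sigma_gt0 : forall i, 0 < sigma (t i))
  (sigma2_diag : forall i, sigma2 (t i) (t i) = sigma (t i) ^+ 2)
  (Sigma_pd : posdef_mx (\matrix_(i, j) sigma2 (t i) (t j)))
  (* Gaussian demand in polar form *)
  (disp : measure_display) (Omega : measurableType disp)
  (P : probability Omega R)
  (W : 'M[R]_d) (rad : {RV P >-> R}) (Psi D : {RV P >-> d.-tuple R})
  (W_fact : W *m W^T = \matrix_(i, j) sigma2 (t i) (t j))
  (rad_gt0 : forall w, 0 < rad w)
  (rad_law : gamma_law (pushforward P (fun w => rad w ^+ 2)) (d%:R / 2) (1 / 2))
  (Psi_law : uniform_sphere_law (distribution P Psi))
  (rad_Psi_indep : independent_RV P rad Psi)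
  (D_polar : forall w,
     colvec (D w) =
     polar_demand (\col_i mu (t i)) W (rad w) (colvec (Psi w)))
  (D_law : gaussian_law (distribution P D) (\col_i mu (t i))
     (\matrix_(i, j) sigma2 (t i) (t j)))
  (* rarity parameter *)
  (beta : R) (beta_gt0 : 0 < beta)
  (k : nat -> R) (k_ge0 : forall n, (0 < n)%N -> 0 <= k n)
  (k_o : k =o_\oo (fun n => n%:R `^ beta)) :
  let supply n : 'cV[R]_d := \col_i (n%:R `^ beta * gamma (t i)) in
  let Tn n (psi : 'cV[R]_d) : \bar R :=
    conditional_tail P A (supply n) (\col_i mu (t i)) W rad (k n) psi in
  let alpha n : \bar R :=
    P [set w | ((k n)%:E < dual_value A (supply n) (colvec (D w)))%E] in
  (exists (n0 : nat) (c3 sstar : R) (eta1 b : nat -> R),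
     [/\ [/\ (0 < n0)%N, 0 < c3 & 0 < sstar],
         eta1 =O_\oo (fun n => n%:R `^ beta),
         b =O_\oo (fun=> 1 : R) &
         forall n, (n0 < n)%N ->
           (forall psi : 'cV[R]_d, enorm psi = 1 ->
              (Tn n psi <=
               P [set w | (n%:R `^ beta * sstar + eta1 n < rad w)%R])%E) /\
           (c3%:E * P [set w | (n%:R `^ beta * sstar + b n < rad w)%R] *
              (n%:R `^ (- (d%:R - 1) * beta))%:E <= alpha n)%E]) /\
  asymptotically_optimal P (fun n w => fine (Tn n (colvec (Psi w))))
    (fun n => fine (alpha n)).
Proof.
move=> supply Tn alpha.
pose M : 'cV[R]_d := \col_i mu (t i).
pose S : 'M[R]_d := \matrix_(i, j) sigma2 (t i) (t j).
pose m n : R := n%:R `^ beta.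
have supplyE n i : supply n i 0 = m n * gamma (t i) by rewrite mxE.
have A_ge0 i j : 0 <= A i j.
  by have [/A_pos/ltW//|/A_zero->] := boolP (E i j).
have SE i : S i i = sigma (t i) ^+ 2 by rewrite mxE sigma2_diag.
pose ratio i := gamma (t i) / sigma (t i).
(* [i0] minimises supply over standard deviation, so its shortage has the slowest exponential
   decay. *)
have [i0 i0_min] : exists i, forall j, ratio i <= ratio j.
  have [i _ imin] := @arg_minP _ _ _ (Ordinal d_gt0) xpredT ratio isT.
  by exists i => j; exact: imin.
pose s0 := ratio i0.
have s0_gt0 : 0 < s0 by rewrite divr_gt0.
(* A shift dominating [mu / sigma] at all nodes at once. *)
pose C := \sum_i mu (t i) / sigma (t i).
have mus_ge0 i : 0 <= mu (t i) / sigma (t i) by rewrite divr_ge0// ltW.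
have C_ge0 : 0 <= C by exact: sumr_ge0.
have CP i : mu (t i) / sigma (t i) <= C.
  by rewrite /C (bigD1 i)//= lerDl sumr_ge0.
have m_ge0 n : 0 <= m n by exact: powR_ge0.
(* The angle comes first, so that the section at an angle is the set of radii defining [Tn]. *)
pose Ev n := [set x : d.-tuple R * R | ((k n)%:E <
  dual_value A (supply n) (polar_demand M W x.2 (colvec x.1)))%E].
have mEv n : measurable (Ev n) by exact: measurable_dual_value_gt.
have TnE n (x : d.-tuple R) :
    Tn n (colvec x) = distribution P rad (xsection (Ev n) x).
  rewrite /Tn /conditional_tail /distribution/= /pushforward/=.
  by congr (P _); apply/seteqP; split=> w /=; rewrite /xsection/= ?inE.
have alphaE n : alpha n = P [set w | Ev n (Psi w, rad w)].
  by congr (P _); apply/seteqP; split=> w /=; rewrite D_polar.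
have mTn n : measurable_fun setT (fun x : d.-tuple R => Tn n (colvec x)).
  under eq_fun do rewrite TnE.
  exact: measurable_fun_xsection.
have mTail r : measurable [set w | r < rad w].
  rewrite (_ : [set _ | _] = setT `&` rad @^-1` `]r, +oo[).
    exact: measurable_funPT.
  by rewrite setTI; apply/seteqP; split=> w /=; rewrite in_itv/= andbT.
have mTnset n (psi : 'cV[R]_d) : measurable [set w |
    ((k n)%:E < dual_value A (supply n) (polar_demand M W (rad w) psi))%E].
  have -> : psi = colvec (tupvec psi).
    by apply/matrixP => i j; rewrite mxE tnth_mktuple ord1.
  rewrite (_ : [set _ | _] = setT `&` rad @^-1` xsection (Ev n) (tupvec psi)).
    by apply: measurable_funPT => //; exact: measurable_xsection.
  by rewrite setTI; apply/seteqP; split=> w /=; rewrite /xsection/= ?inE.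
have Tn_fin n psi : Tn n psi \is a fin_num by exact: fin_num_measure.
have mAlpha n : measurable [set w |
    ((k n)%:E < dual_value A (supply n) (colvec (D w)))%E].
  rewrite (_ : [set _ | _] = setT `&` (fun w => (Psi w, rad w)) @^-1` Ev n).
    by apply: measurable_fun_pair => //; exact: measurable_funPT.
  by rewrite setTI; apply/seteqP; split=> w /=; rewrite D_polar.
have alpha_fin n : alpha n \is a fin_num by exact: fin_num_measure.
pose p r := fine (P [set w | r < rad w]).
have pE r : P [set w | r < rad w] = (p r)%:E by rewrite fineK// fin_num_measure.
have p_ge0 r : 0 <= p r by rewrite fine_ge0.
have p_le1 r : p r <= 1 by rewrite -lee_fin -pE probability_le1.
have p_tail c : 0 <= c -> c < 1 / 2 ->
    exists2 K, 0 < K & forall r, 1 <= r -> p r <= K * expR (- (c * r ^+ 2)).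
  move=> c_ge0 c1; have [K K0 hK] := gamma_law_tail rad_law c_ge0 c1.
  exists K => // r r1; rewrite -lee_fin -pE.
  have r21 : 1 <= r ^+ 2 by rewrite exprn_ege1.
  apply: le_trans (hK _ r21); rewrite /pushforward.
  rewrite le_eqVlt; apply/orP; left; apply/eqP.
  congr (P _); apply/seteqP; split=> w /=; rewrite in_itv/= andbT;
    by rewrite ltr_pXn2r ?nnegrE ?(ltW (rad_gt0 w)) ?(le_trans ler01).
(* The excess over [m n * s0] in the normal bound at [i0]: the level [k n], the unit interval of
   integration and the mean, in units of [sigma]. *)
pose h n := (k n + 1 + mu (t i0)) / sigma (t i0).
have h_ge0 n : (0 < n)%N -> 0 <= h n.
  by move=> n0; rewrite divr_ge0 ?(ltW (sigma_gt0 _))// addr_ge0 ?(ltW (mu_gt0 _))// addr_ge0// k_ge0.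
pose c0 := normal_peak (sigma (t i0)).
have c0_gt0 : 0 < c0 by rewrite normal_peak_gt0// gt_eqF.
have a_ge n : (0 < n)%N ->
    c0 * expR (- ((m n * s0 + h n) ^+ 2 / 2)) <= fine (alpha n).
  move=> n0; rewrite -lee_fin fineK//.
  pose u := m n * gamma (t i0) + k n.
  have u0 : 0 <= u by rewrite addr_ge0 ?k_ge0// mulr_ge0// ltW.
  have := @normal_prob_tail_ge R (mu (t i0)) _ u (lt0r_neq0 (sigma_gt0 i0)) (ltW (mu_gt0 i0)) u0.
  have -> : - (u + 1 + mu (t i0)) ^+ 2 / (sigma (t i0) ^+ 2 *+ 2) =
      - ((m n * s0 + h n) ^+ 2 / 2).
    by rewrite /s0 /ratio /h /u; field; rewrite gt_eqF.
  move=> /le_trans; apply.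
  have := gaussian_law_coord i0 D_law (measurable_itv `]u, +oo[).
  rewrite -/S SE sqrtr_sqr gtr0_norm// mxE => <-.
  apply: (@le_measure _ _ _ P); rewrite ?inE//.
    have mD : measurable_fun setT (fun w => tnth (D w) i0).
      by apply: (measurableT_comp (measurable_tnth i0)); exact: measurable_funPT.
    rewrite (_ : D @^-1` _ = setT `&` (fun w => tnth (D w) i0) @^-1` `]u, +oo[).
      by apply: mD => //; exact: measurable_itv.
    by rewrite setTI.
  move=> w /=; rewrite in_itv/= andbT => uD.
  by apply: (@dual_value_ge_shortage _ _ _ _ _ i0) => //; rewrite supplyE mxE.
have h_o x e : 0 < e -> \forall n \near \oo, x + h n <= e * m n.
  move=> e0; have sg0 := sigma_gt0 i0.
  have e20 : 0 < e * sigma (t i0) / 2 by rewrite divr_gt0// mulr_gt0.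
  (* Half of [e * m n] absorbs [k n / sigma], the other half the constants. *)
  have [N _ hN] := (eqoP _ _ _).1 k_o _ e20.
  have [N' _ hN'] := powR_nat_ge
    ((x + (1 + mu (t i0)) / sigma (t i0)) / (e / 2)) beta_gt0.
  exists (maxn N N') => // n /=; rewrite geq_max => /andP[/hN/= kn /hN'/=].
  rewrite ler_pdivrMr ?divr_gt0// -/(m n).
  move: kn; rewrite (ger0_norm (m_ge0 n)) => /ler_normlP[_ kn] xm.
  have : k n / sigma (t i0) <= e / 2 * m n.
    by rewrite ler_pdivrMr//; lra.
  rewrite /h -addrA mulrDl; lra.
have Tn_le n psi : (0 < n)%N -> enorm psi = 1 ->
    (Tn n psi <= (p (m n * s0 - C))%:E)%E.
  move=> n0 psi1; rewrite -pE; apply: (@le_measure _ _ _ P); rewrite ?inE//.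
  move=> w /= /(dual_value_gt0_shortage (k_ge0 n n0))[i].
  rewrite supplyE => /(polar_demand_radius_gt (sigma_gt0 i)).
  rewrite -SE W_fact => /(_ erefl psi1 (rad_gt0 w)); apply: le_lt_trans.
  rewrite mxE mulrBl lerB ?CP// -mulrA ler_wpM2l//; exact: i0_min.
split.
  have [n0 [c3 [n0_gt0 c3_gt0 hc3]]] :=
    tail_le_lower_bound c0_gt0 s0_gt0 h_ge0 p_tail a_ge h_o.
  (* k n may be unbounded, so the rate s0 with a bounded shift would be too
     optimistic in the lower bound; the larger rate 3 * s0 is not, and eta1
     makes up the difference in the upper bound. *)
  exists n0, c3, (3 * s0), (fun n => - (2 * m n * s0) - C), (fun=> 0).
  split.
  - by split=> //; rewrite mulr_gt0.
  (* Once [m n >= 1], [C <= C * m n], so [2 * s0 + C] is a valid constant. *)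
  - apply/eqOP; near=> B; have [N _ hN] := powR_nat_ge 1 beta_gt0.
    exists N => // n /hN/=; rewrite -/(m n) (ger0_norm (m_ge0 n)) => mn.
    rewrite -opprD normrN ger0_norm; last first.
      by apply: addr_ge0 => //; apply: mulr_ge0; [exact: mulr_ge0|exact: ltW].
    have : 2 * s0 + C <= B by near: B; apply: nbhs_pinfty_ge; exact: num_real.
    by move=> /(ler_wpM2r (m_ge0 n)); have := ler_wpM2l C_ge0 mn; lra.
  - apply/eqOP; near=> B; apply: nearW => n; rewrite normr0 normr1 mulr1.
    by near: B; apply: nbhs_pinfty_ge; exact: num_real.
  move=> n nn0; have n_gt0 : (0 < n)%N by exact: leq_trans nn0.
  split=> [psi psi1|].
    rewrite -/(m n) pE (_ : _ + _ = m n * s0 - C); last by ring.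
    exact: Tn_le.
  rewrite addr0 -/(m n) pE -!EFinM -[alpha n]fineK// lee_fin.
  (* The polynomial factor is at most 1 because [d >= 1]. *)
  rewrite (le_trans _ (hc3 n nn0))// ler_piMr ?mulr_ge0 ?(ltW c3_gt0)//.
  rewrite -[leRHS](powRr0 n%:R) ler_powR ?ler1n// mulr_le0_ge0 ?(ltW beta_gt0)//.
  by rewrite oppr_le0 subr_ge0 ler1n.
apply: (@asymptotically_optimal_of_sqr_bound _ _ _ _ _ _ (fun n => p (m n * s0 - C))).
- move=> n _; apply: measurableT_comp; first exact: fine_measurable.
  apply: (measurableT_comp (mTn n)); exact: measurable_funPT.
- by move=> n w _; rewrite fine_ge0.
- move=> n n0; apply/andP; split; last first.
    by rewrite -lee_fin fineK// probability_le1.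
  by rewrite (lt_le_trans _ (a_ge n n0))// mulr_gt0// expR_gt0.
- move=> n n0; rewrite unlock fineK// alphaE.
  rewrite -(independent_RV_joint rad_Psi_indep (mEv n)).
  by apply: eq_integral => w _; rewrite fineK.
- by move=> n n0; rewrite p_ge0 p_le1.
(* The angle has norm 1 only almost surely, so the uniform bound on [Tn] holds off a null set. *)
- move=> n n0; have [Psi1 _] := Psi_law.
  have menorm : measurable_fun setT (fun w => enorm (colvec (Psi w))).
    apply: measurableT_comp.
      by apply: continuous_measurable_fun; exact: sqrt_continuous.
    under eq_fun do under eq_bigr do rewrite mxE.
    apply: measurable_sum => i; apply: measurable_funX.
    by apply: (measurableT_comp (measurable_tnth i)); exact: measurable_funPT.
  have mE : measurable [set w | enorm (colvec (Psi w)) = 1].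
    by rewrite -[X in measurable X]setTI; exact: (menorm measurableT [set 1]).
  exists (~` [set w | enorm (colvec (Psi w)) = 1]); split.
  + exact: measurableC.
  + by rewrite probability_setC// [X in (1 - X)%E]Psi1 subee.
  move=> w /= H psi1; apply: H; rewrite -lee_fin fineK//; exact: Tn_le.
move=> e e0 e1.
by have := sqr_tail_le_powR c0_gt0 s0_gt0 C_ge0 m_ge0 h_ge0 p_ge0 p_tail a_ge h_o e0 e1.
Unshelve. all: by end_near.
Qed.
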